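(* Let $n$ and $k$ be integers with $1\le k\le n-1$, and let $|\mathrm{PPF}_n^{(k)}|$ denote the number of prime parking functions of length $n$ with exactly $k$ cyclic points. Then $$|\mathrm{PPF}_n^{(k)}|=k\,k!\binom{n-1}{k}(n-1)^{n-k-2}.$$
   Context: Let $[n]=\{1,\dots,n\}$. A parking function of length $n$ is a sequence $\pi_n=(\pi_n(1),\dots,\pi_n(n))\in[n]^n$ such that $|\{k\in[n]:\pi_n(k)\le i\}|\ge i$ for all $i\in[n]$. A parking function $\pi_n$ of length $n$ is prime if $|\{k\in[n]:\pi_n(k)\le j\}|\ge j+1$ for all $1\le j\le n-1$. Viewing $\pi_n$ as a map $[n]\to[n]$, its digraph $G_{\pi_n}$ is the directed graph with vertex set $[n]$ and a directed edge from $i$ to $\pi_n(i)$ for every $i\in[n]$ (a fixed point gives a self-loop, which is a cycle of length $1$). A cyclic point of $\pi_n$ is a vertex lying on a directed cycle of $G_{\pi_n}$. *)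

(* Defs.v *)
From mathcomp Require Import all_boot all_order all_algebra.

Set Implicit Arguments.
Unset Strict Implicit.
Unset Printing Implicit Defensive.

(* The set [n] = {1, ..., n} is encoded by 'I_n, where the ordinal i stands    *)
(* for the integer i.+1.  Thus, for i : 'I_n, the inequality pi k <= i below   *)
(* is the inequality pi(k) <= i.+1 of the 1-based convention.                  *)

Section ParkingFunctions.

Variables (n : nat) (pi : {ffun 'I_n -> 'I_n}).

Definition parking_function : bool :=
  [forall i : 'I_n, i.+1 <= #|[set k : 'I_n | pi k <= i]|].

(* The 1-based index of the prime condition is j.+1, and j.+1 <= n - 1 is      *)
(* written j.+1 < n.                                                           *)
Definition prime_parking_function : bool :=
  parking_function &&
  [forall j : 'I_n, (j.+1 < n) ==> (j.+2 <= #|[set k : 'I_n | pi k <= j]|)].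

Definition digraph : rel 'I_n := [rel i j | j == pi i].

(* A directed cycle has no repeated vertex, so its length m is at most n;      *)
(* bounding m makes the quantifier range over a finite type, see cyclicP.      *)
Definition cyclic (x : 'I_n) : bool :=
  [exists m : 'I_n.+1, exists c : m.-tuple 'I_n, ucycleb digraph c && (x \in c)].

Lemma cyclicP (x : 'I_n) :
  reflect (exists2 c : seq 'I_n, ucycle digraph c & x \in c) (cyclic x).
Proof.
apply: (iffP existsP) => [[m /existsP[c /andP[cyc_c xc]]]|[c cyc_c xc]].
  by exists c.
have uc : uniq c by case/andP: cyc_c.
have lt_c : size c < n.+1.
  by rewrite ltnS -[leqRHS]card_ord -(card_uniqP uc) max_card.
exists (Ordinal lt_c); apply/existsP; exists (in_tuple c).
by apply/andP; split.
Qed.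

Definition cyclic_points : {set 'I_n} := [set x | cyclic x].

End ParkingFunctions.

Definition PPF (n k : nat) : {set {ffun 'I_n -> 'I_n}} :=
  [set pi : {ffun 'I_n -> 'I_n} |
    prime_parking_function pi & #|cyclic_points pi| == k].

(* Main.v *)
Require Import Defs.
From mathcomp Require Import all_boot all_order all_algebra.
From mathcomp Require Import fingroup perm zify.

Import Order.TTheory GRing.Theory Num.Theory.

(** Why the formula holds.  Put m = n - 1; then k k! C(m, k) m^(m-k-1) is the
    number of maps of an m-element set to itself with k cyclic points.  It
    arises here in three steps.

    From cyclic points to a first repetition.  Let X be a set of maps [n] -> [n]
    that is stable under permuting the arguments, as the set of prime parking
    functions is.  Fix a k-element set K of arguments and x outside K.  Then X
    has as many maps with exactly k cyclic points as maps v that are injective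
    on K with v x in v(K) ([card_cyclic_points]): the number of cyclic points
    has the law of the time before the first repeated letter, when v is read as
    a word.  Sorting both sides by the k-element set S = C(f), respectively
    S = v(K), and permuting the arguments so that K becomes S, one has to
    compare the f with C(f) = S to the g with g(S) = S and g y in S, where y is
    any point outside S.  All these maps permute S, so the complementary
    statement suffices: there are as many f with f(S) = S whose cyclic set is
    larger than S as g with g(S) = S and g y outside S ([card_larger_core]).
    This has a short bijective proof, because precomposing f with a permutation
    of C(f) leaves C(f) unchanged ([cyclic_points_precomp]).

    Pollak's rotation.  The values of a prime parking function lie in a set of
    m letters, viewed as Z/m.  Adding a constant to all letters does not affect
    the repetition condition, and exactly one of the m rotations of any word of
    length m + 1 is prime ([card_prime_shift]), by the cycle lemma
    ([cycle_lemma]).  So 1/m of the words with the repetition condition are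
    prime.

    Counting words.  Rotating a single letter instead of all of them shows that
    the letter at x falls into a prescribed set of b letters, depending on the
    others, for a proportion b/m of the words ([card_last_letter]).  This gives
    the factors (m)_k / m^k for injectivity on K and k/m for the repetition.
    All the averagings are instances of [card_average]. *)

Set Implicit Arguments.
Unset Strict Implicit.
Unset Printing Implicit Defensive.

(** * Finite sets and permutations *)

Lemma card_in_bij (U V : finType) (A : {set U}) (B : {set V})
    (f : U -> V) (g : V -> U) :
  {in A, forall a, f a \in B /\ g (f a) = a} ->
  {in B, forall b, g b \in A /\ f (g b) = b} -> #|A| = #|B|.
Proof.
move=> fA gB; have injf : {in A &, injective f}.
  by move=> a b /fA[_ {2}<-] /fA[_ {2}<-] ->.
rewrite -(card_in_imset injf); apply: eq_card => b; apply/imsetP/idP.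
  by case=> a /fA[? _] ->.
by move=> /gB[? ?]; exists (g b).
Qed.

Lemma perm_imset_card (T : finType) (A B : {set T}) :
  #|A| = #|B| -> exists s : {perm T}, s @: A = B.
Proof.
move=> cAB; pose e (D : {set T}) := enum D ++ enum (~: D).
have e_full D x : x \in e D by rewrite mem_cat !mem_enum inE orbN.
have e_uniq D : uniq (e D).
  rewrite cat_uniq !enum_uniq andbT /=; apply/hasPn => x.
  by rewrite !mem_enum inE.
have size_e D : size (e D) = #|T| by rewrite size_cat -!cardE cardsC.
have [A0|/set0Pn[x0 _]] := eqVneq A set0.
  (* The empty set is apart only because [nth] below needs a default value. *)
  exists 1%g; move: cAB; rewrite A0 cards0 => /esym/eqP; rewrite cards_eq0.
  by move/eqP=> ->; rewrite imset0.
pose h x := nth x0 (e B) (index x (e A)).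
have h_inj : injective h.
  move=> x y /eqP; rewrite nth_uniq ?size_e -?(size_e A) ?index_mem //.
  by move/eqP/index_inj=> -> //.
exists (perm h_inj); apply/eqP; rewrite eqEcard.
rewrite (card_imset _ (@perm_inj _ _)) cAB leqnn andbT.
apply/subsetP=> _ /imsetP[x xA ->]; rewrite permE /h !index_cat !nth_cat.
have lt_x : index x (enum A) < #|B| by rewrite -cAB cardE index_mem mem_enum.
by rewrite mem_enum xA -cardE lt_x -mem_enum mem_nth // -cardE.
Qed.

(** * Cyclic points and permutations of the arguments *)

Section CyclicPoints.

Variable n : nat.
Implicit Types (f g : {ffun 'I_n -> 'I_n}) (s t : {perm 'I_n}) (S K : {set 'I_n}).

Lemma imset_cyclic_points f : f @: cyclic_points f = cyclic_points f.
Proof.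
apply/setP=> y; apply/imsetP/idP => [[x + ->]|]; rewrite !inE.
- case/cyclicP=> c cyc_c xc; apply/cyclicP; exists c => //.
  by case/andP: cyc_c => /next_cycle /(_ xc) /eqP <- _; rewrite mem_next.
- case/cyclicP=> c cyc_c yc; exists (prev c y).
    by rewrite inE; apply/cyclicP; exists c => //; rewrite mem_prev.
  by case/andP: cyc_c => /prev_cycle /(_ yc) /eqP.
Qed.

Lemma inj_cyclic_points f : {in cyclic_points f &, injective f}.
Proof. by apply/imset_injP; rewrite imset_cyclic_points. Qed.

(** With [imset_cyclic_points], this makes the cyclic set the largest set that
    the map sends onto itself, which is how it is used from here on. *)
Lemma sub_cyclic_points f S : f @: S = S -> S \subset cyclic_points f.
Proof.
move=> fS; have injf : {in S &, injective f} by apply/imset_injP; rewrite fS.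
apply/subsetP=> x xS; rewrite inE; apply/cyclicP.
have orbS y : y \in orbit f x -> y \in S.
  rewrite -fconnect_orbit => /iter_findex <-.
  by elim: (findex _ _ _) => //= i IH; rewrite -fS imset_f.
exists (orbit f x); last by rewrite -fconnect_orbit.
apply/andP; split; last exact: orbit_uniq.
rewrite (@eq_cycle _ _ (frel f)); last by move=> i j /=; rewrite eq_sym.
apply/(@orbitPcycle _ f x 0 5) => a b /orbS aS /orbS bS; exact: injf.
Qed.

(** Permutations of the arguments act on maps by precomposition; they preserve
    how often each value is taken. *)
Definition precomp f s : {ffun 'I_n -> 'I_n} := [ffun i => f (s i)].

Lemma precompM f s t : precomp (precomp f s) t = precomp f (t * s)%g.
Proof. by apply/ffunP=> i; rewrite !ffunE permM. Qed.

Lemma precomp1 f : precomp f 1%g = f.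
Proof. by apply/ffunP=> i; rewrite !ffunE perm1. Qed.

Lemma imset_precomp f s S : precomp f s @: S = f @: (s @: S).
Proof.
by rewrite -imset_comp; apply: eq_imset => i /=; rewrite ffunE.
Qed.

(** The cyclic set of [f] is still sent onto itself, so it can only grow; the
    inverse permutation then shows that it does not grow. *)
Lemma cyclic_points_precomp f s :
  perm_on (cyclic_points f) s -> cyclic_points (precomp f s) = cyclic_points f.
Proof.
move=> son; have sub g t : perm_on (cyclic_points g) t ->
    cyclic_points g \subset cyclic_points (precomp g t).
  move=> ton; apply: sub_cyclic_points.
  by rewrite imset_precomp (im_perm_on ton) imset_cyclic_points.
apply/eqP; rewrite eqEsubset sub // andbT.
have son' : perm_on (cyclic_points (precomp f s)) s^-1%g.
  by apply/perm_onV/(subset_trans son)/sub.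
by have := sub _ _ son'; rewrite precompM mulVg precomp1.
Qed.

Lemma perm_on_tperm S a b : a \in S -> b \in S -> perm_on S (tperm a b).
Proof.
move=> aS bS; apply/subsetP=> i; rewrite inE.
by case: tpermP => [->|->|]; rewrite ?eqxx.
Qed.

Lemma imset_tperm S a b : a \notin S -> b \notin S -> tperm a b @: S = S.
Proof.
move=> aS bS; rewrite -[RHS]imset_id; apply: eq_in_imset => i iS.
by rewrite tpermD //; [apply: contraNneq aS | apply: contraNneq bS] => ->.
Qed.

Lemma prime_precomp f s :
  prime_parking_function (precomp f s) = prime_parking_function f.
Proof.
have cnt (j : 'I_n) : #|[set i | precomp f s i <= j]| = #|[set i | f i <= j]|.
  rewrite -(card_preimset [set i | f i <= j] (@perm_inj _ s)).
  by apply: eq_card => i; rewrite !inE ffunE.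
by congr (_ && _); apply: eq_forallb => j; rewrite cnt.
Qed.

Variable X : {set {ffun 'I_n -> 'I_n}}.
Hypothesis XP : forall f s, f \in X -> precomp f s \in X.

(** From [f], move a cyclic point outside [S] to [y] in two steps.  Choose
    [z = pivot f] in [C(f) \ S] as a function of [C(f)] alone and let
    [u = f z].  Exchanging the values at [z] and [u] gives a map [h] with
    [h u = u] and [C(h) = C(f)]; exchanging the values at [u] and [y] then gives
    [g] with [g y = u].  Conversely [u = g y] is read off from [g], which gives
    [h]; since [h u = u], the set [C(h)] is larger than [S], and [z] is
    recovered as the pivot of [h]. *)
Lemma card_larger_core S y : y \notin S ->
  #|[set f in X | (f @: S == S) && (cyclic_points f != S)]| =
  #|[set g in X | (g @: S == S) && (g y \notin S)]|.
Proof.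
move=> yS.
pose pivot f := odflt y [pick z in cyclic_points f :\: S].
have pivotP f : f @: S = S -> cyclic_points f != S ->
    pivot f \in cyclic_points f :\: S.
  move=> fS neqC; rewrite /pivot; case: pickP => //= no.
  case/eqP: neqC; apply/eqP; rewrite eqEsubset sub_cyclic_points // andbT.
  by rewrite -setD_eq0; apply/eqP/setP => z; rewrite no inE.
pose fix_pt f := precomp f (tperm (pivot f) (f (pivot f))).
have rot f : f @: S = S -> cyclic_points f != S ->
    [/\ f (pivot f) \in cyclic_points f, f (pivot f) \notin S &
        pivot f \notin S] /\ pivot f \in cyclic_points f.
  move=> fS neqC; have /setDP[zC zS] := pivotP f fS neqC.
  do !split=> //; first by rewrite -imset_cyclic_points imset_f.
  apply: contra zS; rewrite -{1}fS => /imsetP[i iS eqz].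
  rewrite (inj_cyclic_points zC _ eqz) //.
  exact: (subsetP (sub_cyclic_points fS)).
have tperm_core f u : f @: S = S -> cyclic_points f != S ->
    u \in cyclic_points f :\: S ->
    let h := precomp f (tperm (pivot f) u) in
    [/\ h @: S = S, cyclic_points h = cyclic_points f & pivot h = pivot f].
  move=> fS neqC /setDP[uC uS]; have [[_ _ zS] zC] := rot f fS neqC.
  have eqC := cyclic_points_precomp (perm_on_tperm zC uC).
  by split=> //; rewrite ?imset_precomp ?imset_tperm // /pivot eqC.
(* fix_pt and refix both compute the intermediate map h, from f and from g. *)
pose fwd f := precomp (fix_pt f) (tperm (f (pivot f)) y).
pose refix g := precomp g (tperm (g y) y).
pose bwd g := precomp (refix g) (tperm (pivot (refix g)) (g y)).
apply: (@card_in_bij _ _ _ _ fwd bwd) => [f|g]; rewrite !inE.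
- case/and3P=> fX /eqP fS neqC; have [[uC uS zS] zC] := rot f fS neqC.
  have uD : f (pivot f) \in cyclic_points f :\: S by rewrite inE uS.
  have [hS hC hz] := tperm_core f _ fS neqC uD.
  have wy : fwd f y = f (pivot f) by rewrite !ffunE !tpermR.
  have unw : refix (fwd f) = fix_pt f.
    by rewrite /refix wy /fwd precompM tperm2 precomp1.
  split; last by rewrite /bwd unw wy hz precompM tperm2 precomp1.
  by rewrite wy uS !XP //= andbT imset_precomp imset_tperm // hS.
- case/and3P=> gX /eqP gS uS; set u := g y in uS *.
  have hS : refix g @: S = S by rewrite imset_precomp imset_tperm.
  have hu : refix g u = u by rewrite ffunE tpermL.
  have uC : u \in cyclic_points (refix g).
    rewrite -sub1set; apply: sub_cyclic_points.
    by rewrite imset_set1 hu.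
  have neqC : cyclic_points (refix g) != S.
    by apply: contraNneq uS => <-.
  have uD : u \in cyclic_points (refix g) :\: S by rewrite inE uS.
  have [fS fC fz] := tperm_core (refix g) u hS neqC uD.
  split; first by rewrite !XP //= fS eqxx /= fC.
  have eqz : pivot (bwd g) = pivot (refix g) by [].
  have eqfz : bwd g (pivot (bwd g)) = u.
    by rewrite eqz ffunE tpermL hu.
  rewrite /fwd /fix_pt eqfz eqz /bwd -/u !precompM.
  by rewrite -(mulgA (tperm u y)) tperm2 mulg1 tperm2 precomp1.
Qed.

(** The maps [f] with [f(S) = S] satisfy [C(f) = S] or [C(f)] is larger than
    [S]; they also satisfy [f y] in [S] or not.  The second alternatives have
    the same count. *)
Lemma card_cyclic_core S y : y \notin S ->
  #|[set f in X | cyclic_points f == S]| =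
  #|[set g in X | (g @: S == S) && (g y \in S)]|.
Proof.
move=> yS;
have split_core (P : pred {ffun 'I_n -> 'I_n}) :
    #|[set f in X | f @: S == S]| =
    #|[set f in X | (f @: S == S) && P f]| +
    #|[set f in X | (f @: S == S) && ~~ P f]|.
  rewrite -(cardsID [set f | P f]); congr (_ + _);
    by apply: eq_card => f; rewrite !inE -?andbA // andbC -!andbA.
have := split_core (fun f => cyclic_points f == S).
rewrite (split_core (fun f => f y \in S)) (card_larger_core yS).
move=> /addIn ->; apply: eq_card => f; rewrite !inE.
by case: eqVneq => [<-|]; rewrite ?imset_cyclic_points ?eqxx ?andbF.
Qed.

(** Both sides are sorted by a set [S] of the size of [K], the cyclic set on the
    left and [v(K)] on the right; a permutation of the arguments that sends [K]
    to [S] turns [v] into a map that sends [S] onto itself, with [s x] in the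
    role of [y]. *)
Lemma card_cyclic_points K x : x \notin K ->
  #|[set f in X | #|cyclic_points f| == #|K|]| =
  #|[set v in X | (#|v @: K| == #|K|) && (v x \in v @: K)]|.
Proof.
move=> xK.
have fibre (Q : pred {ffun 'I_n -> 'I_n}) (F : {ffun 'I_n -> 'I_n} -> {set 'I_n}) :
  #|[set f in X | (#|F f| == #|K|) && Q f]| =
  \sum_(S : {set 'I_n} | #|S| == #|K|) #|[set f in X | (F f == S) && Q f]|.
  rewrite -[LHS]sum1_card (partition_big F (fun S => #|S| == #|K|)) /=; last first.
    by move=> f; rewrite inE => /and3P[].
  apply: eq_bigr => S cS; rewrite -[RHS]sum1_card; apply: eq_bigl => f.
  by rewrite !inE; case: (eqVneq (F f) S) => [->|]; rewrite ?cS ?andbT ?andbF.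
transitivity #|[set f in X | (#|cyclic_points f| == #|K|) && true]|.
  by apply: eq_card => f; rewrite !inE andbT.
rewrite (fibre xpredT) (fibre (fun v => v x \in v @: K) (fun v => v @: K)).
apply: eq_bigr => S /eqP cS.
have [s sK] : exists s : {perm 'I_n}, s @: K = S.
  exact: perm_imset_card.
have sxS : s x \notin S by rewrite -sK mem_imset //; exact: perm_inj.
transitivity #|[set f in X | cyclic_points f == S]|.
  by apply: eq_card => f; rewrite !inE andbT.
rewrite (card_cyclic_core sxS).
apply: (@card_in_bij _ _ _ _ (precomp^~ s) (precomp^~ s^-1%g)) => f; rewrite !inE.
- case/and3P=> fX /eqP fS fxS.
  split; last by rewrite precompM mulVg precomp1.
  by rewrite XP //= imset_precomp sK fS eqxx ffunE.
- case/and3P=> fX /eqP fS fxS.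
  have KE : s^-1%g @: S = K.
    rewrite -sK -imset_comp (eq_imset (g := id)) ?imset_id // => i /=.
    by rewrite permK.
  split; last by rewrite precompM mulgV precomp1.
  by rewrite XP //= imset_precomp KE fS eqxx ffunE permK -fS.
Qed.

End CyclicPoints.

(** * Averaging over a group of translations *)

Section Averaging.
Variables (Z : finZmodType) (W : finType) (act : Z -> W -> W).
Hypothesis actK : forall c, cancel (act c) (act (- c)%R).

(** Every translate of [A] meets [Q] in the same number of points, and summing
    over all translates counts each point of [Q] exactly [k] times. *)
Lemma card_average (Q A : pred W) k :
  (forall c w, Q (act c w) = Q w) ->
  (forall w, Q w -> #|[set c | A (act c w)]| = k) ->
  #|Z| * #|[set w | Q w && A w]| = k * #|[set w | Q w]|.
Proof.
move=> QP Ak.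
transitivity (\sum_(c : Z) \sum_(w | Q w) (A (act c w) : nat)).
  rewrite -sum_nat_const; apply: eq_bigr => c _.
  rewrite -sum1_card big_mkcond /=.
  rewrite (reindex (act c)) /=; last first.
    by exists (act (- c)%R) => w _; [|rewrite -{1}[c]opprK]; apply: actK.
  rewrite [RHS]big_mkcond; apply: eq_bigr => w _.
  by rewrite inE QP; case: (Q w) => //=; case: (A _).
rewrite exchange_big /= mulnC -sum_nat_const [RHS](eq_bigl Q); last first.
  by move=> w; rewrite inE.
apply: eq_bigr => w Qw; rewrite -(Ak w Qw) -sum1_card big_mkcond [RHS]big_mkcond.
by apply: eq_bigr => c _; rewrite inE; case: (A _).
Qed.
End Averaging.

(** * Words and the first repeated letter *)

Section Words.
Variables (I : finType) (Z : finZmodType).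
Implicit Types (w : {ffun I -> Z}) (K : {set I}).

Definition move_letter x (c : Z) w := [ffun i => if i == x then (w i + c)%R else w i].

Lemma move_letterK x c : cancel (move_letter x c) (move_letter x (- c)%R).
Proof.
by move=> w; apply/ffunP=> i; rewrite !ffunE; case: eqP => // _; rewrite addrK.
Qed.

Lemma imset_move_letter x c w K : x \notin K -> move_letter x c w @: K = w @: K.
Proof.
move=> xK; apply: eq_in_imset => i iK; rewrite ffunE; case: eqP => // ix.
by rewrite -ix iK in xK.
Qed.

(** The choice [A := id] asks for a repetition at [x], and [A := setC] for a new
    letter at [x]. *)
Lemma card_last_letter (K : {set I}) (x : I) (A : {set Z} -> {set Z}) k :
  x \notin K ->
  (forall B : {set Z}, #|B| = #|K| -> #|A B| = k) ->
  #|Z| * #|[set w : {ffun I -> Z} | (#|w @: K| == #|K|) && (w x \in A (w @: K))]| =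
  k * #|[set w : {ffun I -> Z} | #|w @: K| == #|K|]|.
Proof.
move=> xK cA; apply: (card_average (move_letterK x)) => [c w|w /eqP cw].
  by rewrite imset_move_letter.
rewrite -(cA _ cw) -[RHS](card_imset _ (addrI (- w x)%R)).
apply: eq_card => c; rewrite inE imset_move_letter // ffunE eqxx.
apply/idP/imsetP => [h|[a aA ->]]; last by rewrite addNKr.
by exists (w x + c)%R; rewrite ?addKr.
Qed.

Lemma card_repeat_letter K x : x \notin K ->
  #|Z| * #|[set w : {ffun I -> Z} | (#|w @: K| == #|K|) && (w x \in w @: K)]| =
  #|K| * #|[set w : {ffun I -> Z} | #|w @: K| == #|K|]|.
Proof. by move=> xK; apply: (@card_last_letter K x id). Qed.

(** Each new letter, with [j] letters already taken, is distinct from them for a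
    proportion [(m - j) / m] of the words, [m] being the size of the alphabet. *)
Lemma card_distinct_letters K :
  #|Z| ^ #|K| * #|[set w : {ffun I -> Z} | #|w @: K| == #|K|]| =
  #|Z| ^_ #|K| * #|Z| ^ #|I|.
Proof.
elim: {K}#|K| {-2}K (erefl #|K|) => [|k IH] K cK.
  rewrite cK expn0 ffactn0 !mul1n -card_ffun -cardsT; apply: eq_card => w.
  by rewrite !inE (cards0_eq cK) imset0 cards0.
have [x xK] : exists x, x \in K by apply/card_gt0P; rewrite cK.
have cK' : #|K :\ x| = k by move: cK; rewrite (cardsD1 x) xK => -[].
have x_notin : x \notin K :\ x by rewrite !inE eqxx.
have step (w : {ffun I -> Z}) : (#|w @: K| == #|K|) =
    (#|w @: (K :\ x)| == #|K :\ x|) && (w x \in ~: (w @: (K :\ x))).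
  rewrite -{1}(setD1K xK) imsetU1 cardsU1 cK' cK inE.
  have := leq_imset_card w (K :\ x); rewrite cK'.
  by case: (w x \in _) => /=; lia.
under eq_finset do rewrite step.
rewrite cK expnS -mulnA mulnCA (@card_last_letter (K :\ x) x _ (#|Z| - k)) //.
  by rewrite mulnCA -cK' IH // cK' ffactnSr; lia.
by move=> B cB; rewrite cardsCs setCK cB cK'.
Qed.

End Words.

(** * The cycle lemma and Pollak's rotation *)

(** The function [F t = m G(t) - t] has period [m].  Up to periodicity its
    minimum is the last point where [G] is minimal, since the term [- t] breaks
    ties in favour of later points without outweighing a unit of [G].  From
    that point on, [G] stays strictly above its value there.  Two such points
    [c < c'] in one period are impossible, as they would give
    [G c < G c' < G (c + m) = G c + 1]. *)
Lemma cycle_lemma (m : nat) (G : nat -> int) :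
  0 < m -> (forall t, G (t + m) = (G t + 1)%R) ->
  #|[set c : 'I_m | [forall d : 'I_m, (G c < G (c + d.+1)%N)%R]]| = 1.
Proof.
case: m => // m _ GP.
pose F t : int := (G t * (m.+1)%:Z - t%:Z)%R.
have FP t : F (t + m.+1) = F t by rewrite /F GP; lia.
have Fmod t : F (t %% m.+1) = F t.
  rewrite [in RHS](divn_eq t m.+1) addnC.
  by elim: (t %/ m.+1) => [|q IH]; rewrite ?addn0 // mulSnr addnA FP.
case: (@arg_minP _ _ _ (@ord0 m) xpredT (fun c : 'I_m.+1 => F c)) => // c _ cmin.
apply/eqP/cards1P; exists c; apply/setP=> c'; rewrite !inE.
apply/forallP/eqP => [good|-> d]; last first.
  have := cmin (inord ((c + d.+1) %% m.+1)) isT.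
  rewrite inordK ?ltn_mod // Fmod /F; nia.
have goodc t : c < t <= c + m.+1 -> (G c < G t)%R.
  move=> ct; have : (F c <= F t)%R.
    have := cmin (inord (t %% m.+1)) isT; by rewrite inordK ?ltn_mod // Fmod.
  rewrite /F; nia.
have goodc' t : c' < t <= c' + m.+1 -> (G c' < G t)%R.
  move=> ct; have dlt : t - c' - 1 < m.+1 by lia.
  have := good (Ordinal dlt) => /=.
  by have -> : c' + (t - c' - 1).+1 = t by lia.
have lec := ltn_ord c; have lec' := ltn_ord c'; have Gc := GP c; have Gc' := GP c'.
apply/val_inj => /=; have [lt|lt|//] := ltngtP (c' : nat) c.
- have := goodc' c; have := goodc (c' + m.+1); lia.
- have := goodc c'; have := goodc' (c + m.+1); lia.
Qed.

Section Prime.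
Variable p : nat.
Implicit Types (w : {ffun 'I_p.+2 -> 'I_p.+1}).

(** Prime parking functions of length [p + 2], as words over the cyclic alphabet
    Z/(p + 1).  The bound [j] runs over the whole alphabet, so that the condition
    is about a full period, as in the cycle lemma. *)
Definition prime_word w :=
  [forall j : 'I_p.+1, j.+2 <= #|[set i | w i <= j]|].

Definition shift (c : 'I_p.+1) w : {ffun 'I_p.+2 -> 'I_p.+1} :=
  [ffun i => (w i - c)%R].

Lemma shiftK c : cancel (shift c) (shift (- c)%R).
Proof. by move=> w; apply/ffunP=> i; rewrite !ffunE opprK subrK. Qed.

Lemma imset_shift c w (K : {set 'I_p.+2}) :
  shift c w @: K = (+%R^~ (- c)%R) @: (w @: K).
Proof. by rewrite -imset_comp; apply: eq_imset => i /=; rewrite ffunE. Qed.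

Lemma card_imset_shift c w (K : {set 'I_p.+2}) : #|shift c w @: K| = #|w @: K|.
Proof. by rewrite imset_shift card_imset //; apply: addIr. Qed.

Lemma mem_imset_shift c w (K : {set 'I_p.+2}) x :
  (shift c w x \in shift c w @: K) = (w x \in w @: K).
Proof.
by rewrite imset_shift ffunE (mem_imset (w @: K) (w x) (@addIr _ (- c)%R)).
Qed.

(** Extend the letter counts [r] periodically and let [H] be their partial sums.
    The letters up to [j] of the word rotated by [c] are counted by
    [H (c + j + 1) - H c], so that the rotation is prime iff [G t = H t - t]
    exceeds [G c] at the [p + 1] points after [c].  A word has one letter more
    than the alphabet, hence [G] grows by one over a period. *)
Lemma card_prime_shift w : #|[set c | prime_word (shift c w)]| = 1.
Proof.
pose r (a : 'I_p.+1) := #|[set i | w i == a]|.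
pose H t := \sum_(u < t) r (inZp u).
have window t (j : 'I_p.+1) :
    H (t + j.+1) = H t + #|[set i | shift (inZp t) w i <= j]|.
  rewrite /H big_split_ord; congr (_ + _) => /=.
  rewrite (big_ord_widen p.+1 (fun u => r (inZp (t + u)))) //.
  rewrite -[RHS]sum1_card (partition_big (shift (inZp t) w) (fun u => u <= j)).
    apply: eq_bigr => u lt_uj; rewrite -[LHS]sum1_card; apply: eq_bigl => i.
    have -> : inZp (t + u) = (inZp t + u)%R :> 'I_p.+1.
      by apply: val_inj; rewrite /= modnDml.
    rewrite !inE ffunE addrC -subr_eq.
    by case: eqP => [->|]; rewrite ?andbF // -ltnS lt_uj.
  by move=> i; rewrite inE.
have period t : H (t + p.+1) = H t + p.+2.
  rewrite (window t ord_max); congr (_ + _).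
  rewrite -[RHS]card_ord -cardsT; apply: eq_card => i.
  by rewrite !inE -ltnS ltn_ord.
rewrite -(@cycle_lemma p.+1 (fun t => (H t)%:Z - t%:Z)%R) // => [|t].
  apply: eq_card => c; rewrite !inE; apply: eq_forallb => j.
  by rewrite window valZpK; lia.
by rewrite period; lia.
Qed.

(** A prime parking function never takes the largest value
    ([prime_word_mapP]), so prime words account for all of them. *)
Definition word_map w : {ffun 'I_p.+2 -> 'I_p.+2} :=
  [ffun i => widen_ord (leqnSn p.+1) (w i)].

Lemma prime_word_map w : prime_parking_function (word_map w) = prime_word w.
Proof.
have cnt (j : 'I_p.+2) : #|[set i | word_map w i <= j]| = #|[set i | w i <= j]|.
  by apply: eq_card => i; rewrite !inE ffunE.
apply/andP/forallP => [[_ /forallP pr] j|pr].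
- case: (ltnP j.+1 p.+2) => [lt|]; last by rewrite ltnNge ltn_ord.
  have := pr (widen_ord (leqnSn p.+1) j).
  by rewrite cnt /= lt.
- have pr' (j : 'I_p.+2) : j < p.+1 -> j.+2 <= #|[set i | word_map w i <= j]|.
    by move=> lt; rewrite cnt; apply: (pr (Ordinal lt)).
  split; apply/forallP => j; last by apply/implyP/pr'.
  have [lt|ge] := ltnP j p.+1; first exact/ltnW/pr'.
  suff -> : [set k | word_map w k <= j] = setT by rewrite cardsT card_ord.
  apply/setP=> k; rewrite !inE ffunE /=; apply: leq_trans ge.
  exact/ltnW.
Qed.

Lemma prime_word_mapP (f : {ffun 'I_p.+2 -> 'I_p.+2}) :
  prime_parking_function f -> exists w, f = word_map w.
Proof.
case/andP=> _ /forallP/(_ (inord p)).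
rewrite inordK ?ltnS ?leqnSn //= leqnn => /= full.
have all_le i : f i <= p.
  have : [set k | f k <= p] == setT.
    by rewrite eqEcard subsetT cardsT card_ord.
  by move/eqP/setP/(_ i); rewrite !inE.
exists [ffun i => inord (f i)]; apply/ffunP=> i; rewrite !ffunE.
by apply: val_inj; rewrite /= inordK // ltnS.
Qed.

Lemma card_prime_functions (K : {set 'I_p.+2}) x :
  #|[set f in [set f : {ffun 'I_p.+2 -> 'I_p.+2} | prime_parking_function f] |
      (#|f @: K| == #|K|) && (f x \in f @: K)]| =
  #|[set w : {ffun 'I_p.+2 -> 'I_p.+1} |
      ((#|w @: K| == #|K|) && (w x \in w @: K)) && prime_word w]|.
Proof.
have map_inj : injective word_map.
  move=> w w' /ffunP E; apply/ffunP => i; have := E i; rewrite !ffunE.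
  by move/(congr1 val) => /= /val_inj.
rewrite -[RHS](card_imset _ map_inj); apply: eq_card => f.
have wid_inj : injective (widen_ord (leqnSn p.+1)).
  by move=> a b /(congr1 val) /= /val_inj.
have img w : word_map w @: K = widen_ord (leqnSn p.+1) @: (w @: K).
  by rewrite -imset_comp; apply: eq_imset => i /=; rewrite ffunE.
have QE w : (#|word_map w @: K| == #|K|) && (word_map w x \in word_map w @: K) =
    (#|w @: K| == #|K|) && (w x \in w @: K).
  by rewrite img card_imset // ffunE mem_imset.
rewrite !inE; apply/andP/imsetP => [[prf Qf]|[w + ->]].
  have [w Ew] := prime_word_mapP prf; exists w => //.
  by rewrite inE -QE -prime_word_map -Ew Qf.
by rewrite inE -QE -prime_word_map => /andP[].
Qed.

(** Multiplying by powers of the alphabet size keeps the three averaging factors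
    free of division. *)
Lemma card_PPF (k : nat) : k <= p.+1 ->
  p.+1 ^ k.+2 * #|PPF p.+2 k| = k * p.+1 ^_ k * p.+1 ^ p.+2.
Proof.
move=> le_k.
pose K := [set i : 'I_p.+2 | i < k]; pose x : 'I_p.+2 := ord_max.
have cK : #|K| = k.
  rewrite -[LHS]sum1_card -[RHS]card_ord -[RHS]sum1_card.
  rewrite (big_ord_widen p.+2 (fun=> 1)) ?(leq_trans le_k) //.
  by apply: eq_bigl => i; rewrite inE.
have xK : x \notin K by rewrite inE -leqNgt.
have -> : #|PPF p.+2 k| =
    #|[set f in [set f : {ffun 'I_p.+2 -> 'I_p.+2} | prime_parking_function f] |
        #|cyclic_points f| == #|K|]|.
  by apply: eq_card => f; rewrite !inE cK.
rewrite (card_cyclic_points _ xK); last first.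
  by move=> f s; rewrite !inE prime_precomp.
rewrite card_prime_functions.
have avg := @card_average _ _ shift shiftK
  (fun w : {ffun 'I_p.+2 -> 'I_p.+1} =>
     (#|w @: K| == #|K|) && (w x \in w @: K)) prime_word 1.
have rep := @card_repeat_letter 'I_p.+2 'I_p.+1 K x xK.
have dis := @card_distinct_letters 'I_p.+2 'I_p.+1 K.
rewrite !card_ord in avg rep dis.
rewrite [_ ^ k.+2]expnSr [p.+1 ^ k.+1]expnSr -(mulnA _ p.+1) avg.
- by rewrite mul1n -mulnA rep cK mulnCA -mulnA -cK dis.
- by move=> c w; rewrite card_imset_shift mem_imset_shift.
- by move=> w _; apply: card_prime_shift.
Qed.
End Prime.

(** * The formula *)

Local Open Scope ring_scope.

(* The exponent n - k - 2 is an integer, equal to -1 when k = n - 1, hence the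
   equality is stated in the rational numbers. *)
Theorem theorem3p3 (n k : nat) (hk : (1 <= k <= n - 1)%N) :
  (#|PPF n k|)%:R =
    (k * k`! * 'C(n - 1, k))%:R * (n - 1)%N%:R ^ (n%:Z - k%:Z - 2) :> rat.
Proof.
case: n hk => [|[|p]] hk; [lia..|].
rewrite subSS subn0 in hk *; case/andP: hk => _ le_k.
have m0 : p.+1%:R != 0 :> rat by rewrite pnatr_eq0.
apply: (mulfI (expf_neq0 k.+2 m0)).
rewrite -natrX -natrM card_PPF // -[in RHS]mulnA (mulnC k`!) bin_ffact.
rewrite natrM mulrCA; congr (_ * _).
rewrite 2!natrX !exprnP -expfzDr //; congr (_ ^ _); lia.
Qed.
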